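(* Consider minimizing $f:\mathbb{R}^n\to\mathbb{R}$ by a generalized pattern search algorithm, at iteration $k$ with current iterate $x_k$ and mesh $M_k$. Let $X=\{x_j\}_{j=0}^{N-1}\subseteq M_k$ be a set of $N$ mesh points, $t$ of which are improved mesh points (i.e. $f(x_j)<f(x_k)$). Run the Quantum Search Step (described in the context) on $X$ with tolerance $\tau>0$. Then exactly one of the following holds: (i) the quantum search step returns an improved mesh point using $\Theta\left(\sqrt{N/t}\right)$ calls to the quantum oracle $F$; (ii) the quantum search step terminates without finding the next iterate. Moreover, if $X$ contains an improved mesh point, the probability of the quantum search step terminating without finding the next iterate can be made arbitrarily low (by the choice of $\tau$).
   Context: Generalized pattern search: the mesh at iteration $k$ is $M_k=\{x_k+\Delta_k Dz: z\in\mathbb{N}^p\}$, where $\Delta_k>0$ and $D$ is an $n\times p$ real matrix whose columns positively span $\mathbb{R}^n$ and are of the form $Gz_i$ for a nonsingular $G\in\mathbb{R}^{n\times n}$ and $z_i\in\mathbb{Z}^n$. A point $y\in M_k$ is an improved mesh point if $f(y)<f(x_k)$. Points and function values are encoded as fixed-point two's complement bit strings in qubit registers (each coordinate with $d$ bits), and one assumes a quantum oracle $F$ with $F\ket{x}\ket{0}=\ket{x}\ket{f(x)}$, acting linearly on superpositions. Write $f_j=f(x_j)$, $f_k=f(x_k)$. The algorithm $\mathcal{A}$ acts on three registers: it places the third register in $\ket{-f_k}$, puts the first register into the uniform superposition $\frac{1}{\sqrt N}\sum_j\ket{x_j}$, applies $F$ to the first two registers, and adds the second register into the third (in-place signed quantum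 addition), giving $\mathcal{A}\ket{0}\ket{0}\ket{0}=\frac{1}{\sqrt N}\sum_{j=0}^{N-1}\ket{x_j}\ket{f_j}\ket{f_j-f_k}$. Desired states are those basis states with $f_j-f_k<0$ (sign bit of the third register equal to $1$). $S_0$ negates the all-zeros basis state and fixes all others; $S_\chi$ negates desired basis states and fixes all others; $Q=-\mathcal{A}S_0\mathcal{A}^{-1}S_\chi$. Modified QSearch with tolerance $\tau>0$: set $l=0$, $u=0$, fix $1<c<2$. Prepare $\mathcal{A}\ket{0}$ and measure; if desired, return it. While no desired state has been returned and $u<\ln(\tau)/\ln(3/4)$: increase $l$ by 1, set $M=\lceil c^l\rceil$; if $M>\sqrt N$ increase $u$ by 1; prepare $\mathcal{A}\ket{0}$, choose $j$ uniformly from the integers in $[1,M]$, apply $Q$ $j$ times, measure, and return the state if it is desired. If the loop ends without a desired state, report failure. Quantum Search Step: apply modified QSearch to three registers initialized to $\ket{0}\ket{0}\ket{0}$; if it returns an improved mesh point $x'$, set $x_{k+1}=x'$ (and update the mesh size parameter); otherwise terminate and report failure to find an improved mesh point.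
   Formalization: The Θ(√(N/t)) bound is proved for 0<τ<1 only (for τ≥1 just one oracle call is made, so Θ fails) and for the expected number of calls of the whole step, averaged over returning and failing runs, since a single run can return after one call; the constants may depend on c and τ. *)

(* Defs.v *)
From mathcomp Require Import all_boot all_algebra.
From mathcomp Require Import complex.
From mathcomp Require Import all_classical all_reals all_analysis.
Set Implicit Arguments. Unset Strict Implicit. Unset Printing Implicit Defensive.
Import GRing.Theory Num.Theory.
Local Open Scope ring_scope.

(* Fixed-point two's complement words of d bits (bit i has weight 2^i,     *)
(* bit d-1 is the sign bit), with q fractional bits.                        *)
Definition word (d : nat) := (d.-tuple bool)%type.

Definition unsignedw d (w : word d) : nat := (\sum_(i < d) (tnth w i) * 2 ^ i)%N.
Definition signbit d (w : word d) : bool := nth false w d.-1.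
Definition fxval (R : realType) d (q : nat) (w : word d) : R :=
  ((unsignedw w)%:R - (signbit w)%:R * 2 ^+ d) / 2 ^+ q.
Definition word_of_nat d (m : nat) : word d := [tuple odd (m %/ 2 ^ i) | i < d].
Definition zerow d : word d := [tuple false | _ < d].
(* in-place signed (two's complement, i.e. modulo 2^d) addition *)
Definition addw d (a b : word d) : word d :=
  word_of_nat d ((unsignedw a + unsignedw b) %% 2 ^ d).
Definition decx (R : realType) n d q (e : n.-tuple (word d)) : 'cV[R]_n :=
  \col_(i < n) fxval R q (tnth e i).

Section Quantum.
Variable R : realType.
Local Notation C := R[i].
Variable B : finType.

Definition qstate := B -> C.
Definition qop := B -> B -> C.          (* matrix entries <b|U|b'> *)
Definition ket (b : B) : qstate := fun b' => (b' == b)%:R.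
Definition qapply (U : qop) (psi : qstate) : qstate :=
  fun b => \sum_(b' : B) U b b' * psi b'.
Definition qcomp (U V : qop) : qop :=
  fun b b'' => \sum_(b' : B) U b b' * V b' b''.
Definition qadj (U : qop) : qop := fun b b' => conjc (U b' b).
Definition unitary (U : qop) : Prop :=
  forall a a' : B, \sum_(b : B) conjc (U b a) * U b a' = (a == a')%:R.
Definition prob (z : C) : R := complex.Re z ^+ 2 + complex.Im z ^+ 2.

Variables (A : qop) (b0 : B) (good : pred B) (N : nat) (c tau : R).

Definition S0 : qop := fun b b' =>
  if b == b' then (if b == b0 then -1 else 1) else 0.
Definition Schi : qop := fun b b' =>
  if b == b' then (if good b then -1 else 1) else 0.
Definition Qop : qop := fun b b' => - qcomp A (qcomp S0 (qcomp (qadj A) Schi)) b b'.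
Definition psiA : qstate := qapply A (ket b0).
Definition psiQ (j : nat) : qstate := iter j (qapply Qop) psiA.

Definition Mof (l : nat) : nat := `|Num.ceil (c ^+ l)|%N.
Definition qs_bound : R := ln tau / ln (3 / 4).

Inductive outcome :=
  | QFound of B & nat
  | QFailed of nat
  | QRunning of nat.

Definition is_running (o : outcome) := if o is QRunning _ then true else false.
Definition is_failed (o : outcome) := if o is QFailed _ then true else false.
Definition calls (o : outcome) : nat :=
  match o with QFound _ m => m | QFailed m => m | QRunning m => m end.

Definition scale (w : R) (s : seq (R * outcome)) := [seq (w * x.1, x.2) | x <- s].

(* Distribution of the outcomes of the while loop, simulated for at most K
   iterations; state (l, u), [m] oracle calls used so far.  Preparing A|0>
   costs one call of F, each application of Q costs two (A and A^{-1}). *)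
Fixpoint qs_loop (K l u m : nat) : seq (R * outcome) :=
  if ~~ ((u%:R : R) < qs_bound) then [:: (1, QFailed m)] else
  match K with
  | 0 => [:: (1, QRunning m)]
  | K'.+1 =>
    let l' := l.+1 in
    let M := Mof l' in
    let u' := if Num.sqrt (N%:R : R) < M%:R then u.+1 else u in
    flatten [seq
      let psi := psiQ j in
      let m' := (m + (1 + 2 * j))%N in
      [seq ((M%:R)^-1 * prob (psi b), QFound b m') | b <- enum B & good b] ++
      scale ((M%:R)^-1 * \sum_(b | ~~ good b) prob (psi b)) (qs_loop K' l' u' m')
    | j <- iota 1 M]
  end.

Definition qsearch (K : nat) : seq (R * outcome) :=
  [seq (prob (psiA b), QFound b 1) | b <- enum B & good b] ++
  scale (\sum_(b | ~~ good b) prob (psiA b)) (qs_loop K 0 0 1).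

End Quantum.

Definition terminated (R : realType) (B : finType) (s : seq (R * outcome B)) :=
  all (fun x => ~~ is_running x.2) s.
Definition total_prob (R : realType) (B : finType) (s : seq (R * outcome B)) : R :=
  \sum_(x <- s) x.1.
Definition fail_prob (R : realType) (B : finType) (s : seq (R * outcome B)) : R :=
  \sum_(x <- s | is_failed x.2) x.1.
Definition expected_calls (R : realType) (B : finType) (s : seq (R * outcome B)) : R :=
  \sum_(x <- s) x.1 * (calls x.2)%:R.

Definition preg n d := (n.-tuple (word d))%type.
Definition basis3 n d := ((preg n d * word d) * word d)%type.
Definition zero3 n d : basis3 n d := (([tuple zerow d | _ < n], zerow d), zerow d).

Section Circuit.
Variables (R : realType) (n d : nat).
Local Notation C := R[i].
Local Notation B := (basis3 n d).
Definition on1 (W : qop R (preg n d)) : qop R B :=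
  fun b b' => W b.1.1 b'.1.1 * ((b.1.2 == b'.1.2) && (b.2 == b'.2))%:R.
Definition on12 (F : qop R (preg n d * word d)%type) : qop R B :=
  fun b b' => F b.1 b'.1 * (b.2 == b'.2)%:R.
Definition on3 (P : qop R (word d)) : qop R B :=
  fun b b' => P b.2 b'.2 * (b.1 == b'.1)%:R.
Definition ADD : qop R B :=
  fun b b' => (b == (b'.1.1, b'.1.2, addw b'.2 b'.1.2))%:R.
Definition Aop W F P : qop R B :=
  qcomp ADD (qcomp (on12 F) (qcomp (on1 W) (on3 P))).
Definition desired3 : pred B := fun b => signbit b.2.
End Circuit.

Unset Implicit Arguments.
Record qss_instance (R : realType) := QSSInstance {
  gi_n : nat; gi_d : nat; gi_q : nat; gi_p : nat; gi_N : nat;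
  gi_d_gt0 : (0 < gi_d)%N;
  gi_f : 'cV[R]_gi_n -> R;
  gi_xk : 'cV[R]_gi_n;
  gi_Delta : R;
  gi_Delta_gt0 : 0 < gi_Delta;
  gi_G : 'M[R]_gi_n;
  gi_G_unit : gi_G \in unitmx;
  gi_Z : 'M[int]_(gi_n, gi_p);
  gi_D_span : forall v : 'cV[R]_gi_n, exists lam : 'cV[R]_gi_p,
      (forall i, 0 <= lam i 0) /\ (gi_G *m map_mx (fun z : int => z%:~R) gi_Z) *m lam = v;
  gi_N_gt0 : (0 < gi_N)%N;
  gi_cx : 'I_gi_N -> preg gi_n gi_d;
  gi_cx_inj : injective gi_cx;
  gi_cx_mesh : forall j, exists z : 'I_gi_p -> nat,
      decx R gi_q (gi_cx j) =
      gi_xk + gi_Delta *: ((gi_G *m map_mx (fun z : int => z%:~R) gi_Z) *m \col_i (z i)%:R);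
  gi_W : qop R (preg gi_n gi_d);
  gi_W_unitary : unitary gi_W;
  gi_W_spec : qapply gi_W (ket R (zero3 gi_n gi_d).1.1) =
      (fun e => Complex (Num.sqrt (gi_N%:R : R))^-1 0 * (e \in codom gi_cx)%:R);
  gi_F : qop R (preg gi_n gi_d * word gi_d)%type;
  gi_F_unitary : unitary gi_F;
  gi_ef : preg gi_n gi_d -> word gi_d;
  gi_F_spec : forall e, qapply gi_F (ket R (e, zerow gi_d)) = ket R (e, gi_ef e);
  gi_ef_correct : forall j, fxval R gi_q (gi_ef (gi_cx j)) = gi_f (decx R gi_q (gi_cx j));
  gi_wk : word gi_d;
  gi_wk_correct : fxval R gi_q gi_wk = - gi_f gi_xk;
  gi_P : qop R (word gi_d);
  gi_P_unitary : unitary gi_P;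
  gi_P_spec : qapply gi_P (ket R (zerow gi_d)) = ket R gi_wk;
  gi_no_overflow : forall j,
      fxval R gi_q (addw gi_wk (gi_ef (gi_cx j))) =
      gi_f (decx R gi_q (gi_cx j)) - gi_f gi_xk
}.
Set Implicit Arguments.

Section InstanceDefs.
Variables (R : realType) (I : qss_instance R).
Definition gi_x (j : 'I_(gi_N R I)) : 'cV[R]_(gi_n R I) := decx R (gi_q R I) (gi_cx R I j).
Definition gi_t : nat := #|[set j : 'I_(gi_N R I) | gi_f R I (gi_x j) < gi_f R I (gi_xk R I)]|.
Definition gi_A : qop R (basis3 (gi_n R I) (gi_d R I)) := Aop (gi_W R I) (gi_F R I) (gi_P R I).
Definition qss_run (c tau : R) (K : nat) :=
  qsearch gi_A (zero3 (gi_n R I) (gi_d R I)) (@desired3 (gi_n R I) (gi_d R I)) (gi_N R I) c tau K.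
End InstanceDefs.

(* Main.v *)
Require Import Defs.
From Stdlib Require List.
From mathcomp Require Import all_boot all_order all_algebra.
From mathcomp Require Import complex.
From mathcomp Require Import all_classical all_reals all_analysis.
From mathcomp Require Import ring lra zify.
Import Order.TTheory GRing.Theory Num.Theory.
Local Open Scope ring_scope.

(* Writing t / N = p = sin^2 theta for the weight of the desired states in A|0>, Q acts
   as a rotation by 2 theta on the plane spanned by the desired and undesired parts of
   A|0>, so that j applications succeed with probability sin^2 ((2 j + 1) theta).
   Averaged over 1 <= j <= M, the failure probability is at most
   1/2 + 1 / (2 M sin (2 theta)).  Since c < 2, the geometric growth of the cost of the
   stages is beaten once M is a large multiple of 1 / sin (2 theta), so the loop makes
   O (1 / sin (2 theta)) calls on average; it is entered with probability 1 - p only,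
   which turns this bound into O (1 / sqrt p) even for p near 1.  Conversely
   sin^2 ((2 j + 1) theta) <= (2 j + 1)^2 p, so that with probability at least 1/2 the
   stages with M below a small multiple of 1 / sqrt p all fail.  Finally, when 0 < t < N,
   a stage with M > sqrt N fails with probability at most 7/8, and the number of these
   stages that a failing run must go through tends to infinity as tau tends to 0. *)

(** * Operators as matrices: composition, adjoints, unitarity *)

Section Operators.
Context {R : realType} {B : finType}.
Implicit Types (U V X : qop R B) (psi : qstate R B).

Definition qone : qop R B := fun b b' => (b == b')%:R.

Lemma sum_ket (T : finType) (b : T) (F : T -> R[i]) :
  \sum_(b' : T) (b' == b)%:R * F b' = F b.
Proof.
rewrite (bigD1 b) //= eqxx mul1r big1 ?addr0// => i /negPf ->.
by rewrite mul0r.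
Qed.

Lemma qapply_ket U b b' : qapply U (ket R b) b' = U b' b.
Proof. by rewrite /qapply -[RHS]sum_ket; apply: eq_bigr => i _; rewrite mulrC. Qed.

Lemma qcompA U V X : qcomp U (qcomp V X) = qcomp (qcomp U V) X.
Proof.
apply/funext => b; apply/funext => b''; rewrite /qcomp.
under eq_bigr do rewrite mulr_sumr.
rewrite exchange_big /=; apply: eq_bigr => i _; rewrite mulr_suml.
by apply: eq_bigr => j _; rewrite mulrA.
Qed.

Lemma qapply_comp U V psi : qapply (qcomp U V) psi = qapply U (qapply V psi).
Proof.
apply/funext => b; rewrite /qapply /qcomp.
under [RHS]eq_bigr do rewrite mulr_sumr.
rewrite exchange_big /=; apply: eq_bigr => i _; rewrite mulr_suml.
by apply: eq_bigr => j _; rewrite mulrA.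
Qed.

Lemma qcomp1 U : qcomp qone U = U.
Proof.
apply/funext => b; apply/funext => b'; rewrite /qcomp /qone.
by under eq_bigr do rewrite eq_sym; rewrite sum_ket.
Qed.

Lemma qapply1 psi : qapply qone psi = psi.
Proof.
apply/funext => b; rewrite /qapply /qone.
by under eq_bigr do rewrite eq_sym; rewrite sum_ket.
Qed.

Lemma qadj_comp U V : qadj (qcomp U V) = qcomp (qadj V) (qadj U).
Proof.
apply/funext => b; apply/funext => b'; rewrite /qcomp /qadj rmorph_sum /=.
by apply: eq_bigr => i _; rewrite rmorphM mulrC.
Qed.

Lemma unitaryE U : unitary U <-> qcomp (qadj U) U = qone.
Proof.
split=> [uU|eU a a']; last by have := congr1 (fun f => f a a') eU.
by apply/funext => b; apply/funext => b'; exact: uU.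
Qed.

Lemma unitary_comp U V : unitary U -> unitary V -> unitary (qcomp U V).
Proof.
rewrite !unitaryE => uU uV.
by rewrite qadj_comp -qcompA (qcompA (qadj U)) uU qcomp1.
Qed.

(** [unitary] only gives the left inverse. Enumerating the finite basis turns operators into square
    matrices, whose one-sided inverses are two-sided. *)
Lemma unitary_adjr U : unitary U -> qcomp U (qadj U) = qone.
Proof.
move=> /unitaryE uU.
pose mx X : 'M[R[i]]_#|B| := \matrix_(i, j) X (enum_val i) (enum_val j).
have mxM X Y : mx X *m mx Y = mx (qcomp X Y).
  apply/matrixP => i j; rewrite !mxE /qcomp (reindex _ (onW_bij _ (@enum_val_bij B))) /=.
  by apply: eq_bigr => k _; rewrite !mxE.
have mx1 : mx qone = 1%:M.
  by apply/matrixP => i j; rewrite !mxE /qone (inj_eq enum_val_inj).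
have /mulmx1C : mx (qadj U) *m mx U = 1%:M by rewrite mxM uU.
rewrite mxM -mx1 => /matrixP e; apply/funext => b; apply/funext => b'.
by have := e (enum_rank b) (enum_rank b'); rewrite !mxE !enum_rankK.
Qed.

(** Covers [on1], [on12] and [on3] at once: [f] reads the registers acted upon, [g] the spectators,
    and the sum over the basis factors along the two. *)
Lemma unitary_tensor (T S : finType) (f : B -> T) (g : B -> S) (W : qop R T) :
  bijective (fun b => (f b, g b)) -> unitary W ->
  unitary (fun b b' : B => W (f b) (f b') * (g b == g b')%:R).
Proof.
move=> [h hK Kh] uW a a'.
rewrite (reindex h) /=; last by exists (fun b => (f b, g b)) => x _; [exact: Kh|exact: hK].
transitivity (\sum_(k : T) \sum_(s : S) (s == g a)%:R *
   ((s == g a')%:R * (conjc (W k (f a)) * W k (f a')))).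
  rewrite pair_bigA /=; apply: eq_bigr => -[k s] _ /=.
  have := Kh (k, s) => -[-> ->]; rewrite rmorphM rmorph_nat /=; ring.
under eq_bigr do rewrite sum_ket.
rewrite -mulr_sumr uW -natrM mulnb; congr (_%:R); congr nat_of_bool.
by rewrite -(can_eq hK) xpair_eqE andbC.
Qed.

Lemma unitary_bij (f : B -> B) : injective f ->
  unitary (fun b b' : B => (b == f b')%:R : R[i]).
Proof.
move=> fi a a'; rewrite -(inj_eq fi) -(sum_ket _ (f a) (fun b => (b == f a')%:R)).
by apply: eq_bigr => b _; rewrite rmorph_nat.
Qed.

End Operators.

(** * Arithmetic of two's complement words *)

Section Words.
Context {d : nat}.
Implicit Types a b w : word d.

Lemma sum_bits_lt (F : nat -> bool) k : (\sum_(i < k) F i * 2 ^ i < 2 ^ k)%N.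
Proof.
elim: k => [|k IH]; first by rewrite big_ord0.
rewrite big_ord_recr /= expnS mul2n -addnn -addSn leq_add//.
by case: (F k); rewrite ?mul1n ?mul0n.
Qed.

(** The bits below i sum to less than 2^i and vanish in the quotient; the bits above i contribute
    even multiples of 2^i and leave its parity alone. *)
Lemma sum_bits_bit (F : nat -> bool) k i : (i < k)%N ->
  odd ((\sum_(i < k) F i * 2 ^ i) %/ 2 ^ i) = F i.
Proof.
elim: k => // k IH; rewrite ltnS leq_eqVlt big_ord_recr /= => /orP[/eqP->|ik].
  by rewrite addnC divnMDl ?expn_gt0// divn_small ?sum_bits_lt// ?addn0 // oddb.
rewrite divnDr; last by rewrite dvdn_mull// dvdn_exp2l// ltnW.
rewrite oddD IH//.
have [j ->] : exists j, k = (i + j.+1)%N by exists (k - i).-1; rewrite prednK ?subn_gt0// subnKC// ltnW.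
by rewrite expnD mulnCA mulKn ?expn_gt0// oddM expnS oddM andbF addbF.
Qed.

Lemma unsignedw_nth w : unsignedw w = (\sum_(i < d) nth false w i * 2 ^ i)%N.
Proof. by apply: eq_bigr => i _; rewrite (tnth_nth false). Qed.

Lemma unsignedw_lt w : (unsignedw w < 2 ^ d)%N.
Proof. by rewrite unsignedw_nth sum_bits_lt. Qed.

Lemma unsignedwK w : word_of_nat d (unsignedw w) = w.
Proof.
apply: eq_from_tnth => i; rewrite tnth_mktuple unsignedw_nth.
by rewrite (sum_bits_bit (nth false w)) // (tnth_nth false).
Qed.

Lemma word_of_natK m : (m < 2 ^ d)%N -> unsignedw (word_of_nat d m) = m.
Proof.
rewrite /unsignedw; under eq_bigr do rewrite tnth_mktuple.
elim: (d) m => [|k IH] m; first by rewrite big_ord0 expn0 ltnS leqn0 => /eqP->.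
move=> mk; rewrite big_ord_recl /= expn0 divn1 muln1.
under eq_bigr => i _ do rewrite /bump /= add1n expnS divnMA mulnCA.
rewrite -big_distrr /= !divn2 mul2n IH ?odd_double_half//.
by rewrite -divn2 ltn_divLR// mulnC -expnS.
Qed.

(** Addition modulo 2^d cancels; this is what makes [ADD] a permutation of the basis, hence
    unitary. *)
Lemma addw_inj b : injective (fun a => addw a b).
Proof.
move=> a a' /= /(congr1 (@unsignedw d)); rewrite /addw !word_of_natK ?ltn_mod ?expn_gt0// => /eqP.
rewrite eqn_modDr !modn_small ?unsignedw_lt// => /eqP e.
by rewrite -(unsignedwK a) e unsignedwK.
Qed.

Lemma fxval_lt0 (R : realType) q w : (0 < d)%N -> (fxval R q w < 0) = signbit w.
Proof.
move=> d0; have p2 k : 0 < 2 ^+ k :> R by rewrite exprn_gt0.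
rewrite /fxval pmulr_llt0 ?invr_gt0// subr_lt0.
case: (signbit w); last by rewrite mul0r ltrn0.
by rewrite mul1r -natrX ltr_nat unsignedw_lt.
Qed.

End Words.

(** * Unitarity of the circuit *)

Section CircuitUnitary.
Context {R : realType} {n d : nat}.

Lemma unitary_ADD : unitary (@ADD R n d).
Proof.
apply: (@unitary_bij R _ (fun b : basis3 n d => (b.1.1, b.1.2, addw b.2 b.1.2))).
move=> [[e v] w] [[e' v'] w'] eb.
have /= ee := congr1 (fun b => b.1.1) eb; have /= ev := congr1 (fun b => b.1.2) eb.
have /= := congr1 snd eb; rewrite ee ev => /addw_inj -> //.
Qed.

Lemma unitary_Aop (W : qop R (preg n d)) F P :
  unitary W -> unitary F -> unitary P -> unitary (Aop W F P).
Proof.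
move=> uW uF uP; do !apply: unitary_comp.
- exact: unitary_ADD.
- by apply: (unitary_tensor _ _ (fun b : basis3 n d => b.1) (fun b => b.2) F) => //; exists id; case.
- have := @unitary_tensor R (basis3 n d) _ _ (fun b => b.1.1) (fun b => (b.1.2, b.2)) W.
  apply => //.
  by exists (fun x : preg n d * (word d * word d) => ((x.1, x.2.1), x.2.2)) => [[[? ?] ?]|[? [? ?]]].
- apply: (unitary_tensor _ _ (fun b : basis3 n d => b.2) (fun b => b.1) P) => //.
  by exists (fun x => (x.2, x.1)); case.
Qed.
End CircuitUnitary.

(** * Amplitude amplification: Q as a plane rotation *)

Section Amplification.
Local Open Scope complex_scope.
Context {R : realType} {B : finType} (A : qop R B) (b0 : B) (good : pred B).
Hypothesis uA : unitary A.
Implicit Types (a b : R).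

Lemma conjc_mul_prob (z : R[i]) : conjc z * z = (prob z)%:C.
Proof.
by case: z => x y; apply/eqP; rewrite eq_complex /prob /=; apply/andP; split; apply/eqP; ring.
Qed.

Lemma prob_realM a (z : R[i]) : prob (a%:C * z) = a ^+ 2 * prob z.
Proof. by case: z => x y; rewrite /prob /=; ring. Qed.

Lemma prob_ge0 (z : R[i]) : 0 <= prob z.
Proof. by rewrite addr_ge0 ?sqr_ge0. Qed.

Lemma psiAE x : psiA A b0 x = A x b0.
Proof. exact: qapply_ket. Qed.

Definition gprob (psi : qstate R B) : R := \sum_(x | good x) prob (psi x).
Definition bprob (psi : qstate R B) : R := \sum_(x | ~~ good x) prob (psi x).
Let p := gprob (psiA A b0).

Lemma gprob_ge0 psi : 0 <= gprob psi.
Proof. by apply: sumr_ge0 => x _; exact: prob_ge0. Qed.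

Lemma bprob_ge0 psi : 0 <= bprob psi.
Proof. by apply: sumr_ge0 => x _; exact: prob_ge0. Qed.

Lemma gprobD_psiA : p + bprob (psiA A b0) = 1.
Proof.
have -> : p + bprob (psiA A b0) = \sum_x prob (psiA A b0 x) by rewrite (bigID good).
apply: (@complexI R); rewrite rmorph_sum /=.
transitivity ((b0 == b0)%:R : R[i]); last by rewrite eqxx.
rewrite -uA.
by apply: eq_bigr => x _; rewrite psiAE conjc_mul_prob.
Qed.

(** The plane kept invariant by Q, with coordinates [a] and [b] along the desired and undesired
    parts of A|0>; A|0> itself is [scaled 1 1]. *)
Definition scaled a b : qstate R B :=
  fun x => (if good x then a else b)%:C * psiA A b0 x.

Lemma qapply_Schi a b : qapply (Schi R good) (scaled a b) = scaled (- a) b.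
Proof.
apply/funext => x; rewrite /qapply (bigD1 x) //= big1 ?addr0 => [|y /negPf].
  by rewrite /Schi eqxx /scaled; case: ifP => _; rewrite ?mul1r// rmorphN !mulNr mul1r.
by rewrite eq_sym /Schi => ->; rewrite mul0r.
Qed.

Lemma qapply_S0 (psi : qstate R B) :
  qapply (S0 R b0) psi = fun x => psi x - 2 * ((x == b0)%:R * psi b0).
Proof.
apply/funext => x; rewrite /qapply (bigD1 x) //= big1 ?addr0 => [|y /negPf].
  by rewrite /S0 eqxx; case: eqP => [->|_] /=; ring.
by rewrite eq_sym /S0 => ->; rewrite mul0r.
Qed.

Lemma overlap a b : qapply (qadj A) (scaled a b) b0 = (a * p + b * (1 - p))%:C.
Proof.
have -> : 1 - p = bprob (psiA A b0) by rewrite -gprobD_psiA addrC addKr.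
rewrite /qapply (bigID good) /= rmorphD !rmorphM /p /gprob /bprob !rmorph_sum /= !mulr_sumr.
congr (_ + _); apply: eq_bigr => x; rewrite /scaled /qadj -psiAE -conjc_mul_prob.
- by move=> ->; ring.
- by move=> /negPf ->; ring.
Qed.

(** [S0] is the identity minus twice the projection on b0, so A S0 A^{-1} subtracts twice the
    component along A|0>. After [Schi] that component is -a p + b (1 - p), by [overlap]. *)
Lemma qapply_Qop a b : qapply (Qop A b0 good) (scaled a b) =
  scaled ((1 - 2 * p) * a + 2 * (1 - p) * b) ((1 - 2 * p) * b - 2 * p * a).
Proof.
transitivity (fun x => - qapply A (qapply (S0 R b0) (qapply (qadj A) (qapply (Schi R good) (scaled a b)))) x).
  rewrite -!qapply_comp; apply/funext => x; rewrite /qapply -sumrN.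
  by apply: eq_bigr => y _; rewrite -mulNr -!qcompA.
rewrite qapply_Schi qapply_S0 overlap; set chi := qapply (qadj A) _.
apply/funext => x.
have -> : qapply A (fun y => chi y - 2 * ((y == b0)%:R * (- a * p + b * (1 - p))%:C)) x =
   scaled (- a) b x - 2 * (- a * p + b * (1 - p))%:C * psiA A b0 x.
  (* Inserting A A^{-1} = 1 shows that A maps [chi] back to [scaled (- a) b]. *)
  rewrite -[scaled _ _]qapply1 -(unitary_adjr _ uA) qapply_comp -/chi /qapply psiAE.
  under eq_bigr do rewrite mulrBr.
  rewrite sumrB; congr (_ - _).
  rewrite -[A x b0](sum_ket _ b0 (A x)) mulr_sumr.
  by apply: eq_bigr => y _; ring.
rewrite /scaled; case: ifP => _; rewrite !(rmorphD, rmorphB, rmorphM, rmorphN, rmorph1, rmorph_nat) /=; ring.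
Qed.

(* With p = sin^2 theta these factors are sin ((2 j + 1) theta) / sin theta, on the
   desired states, and cos ((2 j + 1) theta) / cos theta, on the others. *)
Fixpoint amp (j : nat) : R * R :=
  if j is j'.+1 then
    let: (a, b) := amp j' in ((1 - 2 * p) * a + 2 * (1 - p) * b, (1 - 2 * p) * b - 2 * p * a)
  else (1, 1).

Lemma psiQE j : psiQ A b0 good j = scaled (amp j).1 (amp j).2.
Proof.
elim: j => [|j IH] /=; first by apply/funext => x; rewrite /scaled if_same mul1r.
by rewrite -[LHS]/(qapply (Qop A b0 good) (psiQ A b0 good j)) IH qapply_Qop; case: (amp j).
Qed.

Lemma gprob_psiQ j : gprob (psiQ A b0 good j) = (amp j).1 ^+ 2 * p.
Proof.
rewrite psiQE /p /gprob mulr_sumr; apply: eq_bigr => x gx.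
by rewrite /scaled gx prob_realM.
Qed.

Lemma bprob_psiQ j : bprob (psiQ A b0 good j) = (amp j).2 ^+ 2 * (1 - p).
Proof.
have -> : 1 - p = bprob (psiA A b0) by rewrite -gprobD_psiA addrC addKr.
rewrite psiQE /bprob mulr_sumr; apply: eq_bigr => x /negPf gx.
by rewrite /scaled gx prob_realM.
Qed.

Lemma gprobD j : gprob (psiQ A b0 good j) + bprob (psiQ A b0 good j) = 1.
Proof.
rewrite gprob_psiQ bprob_psiQ; elim: j => [|j IH] /=; first by ring.
rewrite -[RHS]IH.
by case: (amp j) => a b /=; ring.
Qed.

Lemma gprob_psiA_ge0 : 0 <= p. Proof. exact: gprob_ge0. Qed.
Lemma gprob_psiA_le1 : p <= 1. Proof. by rewrite -gprobD_psiA lerDl bprob_ge0. Qed.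

(** Each rotation adds at most 2 to the absolute value of the desired coordinate, because |1 - 2 p|
    <= 1 and (1 - p) |b| <= 1, the latter by conservation of the norm. *)
Lemma gprob_psiQ_le j : gprob (psiQ A b0 good j) <= (2 * j + 1)%:R ^+ 2 * p.
Proof.
have p0 := gprob_psiA_ge0; have p1 := gprob_psiA_le1.
suff h : `|(amp j).1| <= (2 * j + 1)%:R.
  by rewrite gprob_psiQ ler_wpM2r// -real_normK ?num_real// lerXn2r ?nnegrE.
have hb i : (1 - p) * `|(amp i).2| <= 1.
  have e := gprobD i; have g0 := gprob_ge0 (psiQ A b0 good i).
  rewrite -(@ler_pXn2r _ 2) ?nnegrE ?mulr_ge0 ?subr_ge0// expr1n.
  rewrite exprMn real_normK ?num_real// expr2 -mulrA (mulrC (1 - p) (_ ^+ 2)) -bprob_psiQ.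
  by have := bprob_ge0 (psiQ A b0 good i); nra.
elim: j => [|j IH]; first by rewrite normr1.
have := hb j; move: IH => /=; case: (amp j) => a b /= ha hb'.
apply: le_trans (ler_normD _ _) _; rewrite !normrM.
rewrite (@ger0_norm _ (1 - p)) ?subr_ge0// (@ger0_norm _ 2)//.
have : `|1 - 2 * p| <= 1 by rewrite ler_norml; lra.
have : 0 <= `|a| by []. 
rewrite mulnS addnAC natrD => a0 c0; have : `|1 - 2 * p| * `|a| <= `|a| by rewrite ler_piMl.
lra.
Qed.

(* With p = sin^2 theta, s is sin (2 theta), the summand is cos^2 ((2 j + 1) theta), x j
   below is cos ((4 j + 2) theta) and z j is sin (4 j theta) / (2 s), so the sum telescopes. *)
Lemma sum_bprob_psiQ M (s : R) : s ^+ 2 = 4 * p * (1 - p) -> 0 < s ->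
  \sum_(j <- iota 1 M) bprob (psiQ A b0 good j) <= M%:R / 2 + 1 / (2 * s).
Proof.
move=> es s0; have p0 := gprob_psiA_ge0; have p1 := gprob_psiA_le1.
pose x i := (amp i).2 ^+ 2 * (1 - p) - (amp i).1 ^+ 2 * p.
(* This is sin ((4 i + 2) theta), so [xy] is the Pythagorean identity and [z] comes from the sine of
   a difference with 2 theta. *)
pose y i := s * ((amp i).1 * (amp i).2).
pose z i := (y i * (1 - 2 * p) - x i * s) / (2 * s).
have sn0 : s != 0 by rewrite gt_eqF.
have xy i : x i ^+ 2 + y i ^+ 2 = 1.
  have := gprobD i; rewrite gprob_psiQ bprob_psiQ => e.
  transitivity (((amp i).1 ^+ 2 * p + (amp i).2 ^+ 2 * (1 - p)) ^+ 2); last by rewrite e expr1n.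
  by rewrite /x /y exprMn es; ring.
have zz i : `|z i| <= 1 / (2 * s).
  rewrite /z normrM (@ger0_norm _ (_^-1)) ?invr_ge0 ?mulr_ge0 ?(ltW s0)//.
  rewrite ler_wpM2r ?invr_ge0 ?mulr_ge0 ?(ltW s0)//.
  rewrite -(@ler_pXn2r _ 2) ?nnegrE// real_normK ?num_real// expr1n.
  have : 0 <= (y i * s + x i * (1 - 2 * p)) ^+ 2 by rewrite sqr_ge0.
  (* The two-square identity; both factors on the right equal 1. *)
  have e : (y i * (1 - 2 * p) - x i * s) ^+ 2 + (y i * s + x i * (1 - 2 * p)) ^+ 2 = 
        (x i ^+ 2 + y i ^+ 2) * ((1 - 2 * p) ^+ 2 + s ^+ 2) by ring.
  by move: e; rewrite xy es; nra.
have step i : x i = z i.+1 - z i.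
  rewrite /z -mulrBl; apply: (canRL (mulfK _)); first by rewrite mulf_neq0 ?pnatr_eq0.
  rewrite /x /y /=; case: (amp i) => a b /=.
  ring: es.
have -> : \sum_(j <- iota 1 M) bprob (psiQ A b0 good j) = \sum_(j <- iota 1 M) ((1 + x j) / 2).
  apply: eq_bigr => j _; have := gprobD j; rewrite gprob_psiQ bprob_psiQ /x; lra.
rewrite -mulr_suml big_split /= big_const_seq /= iter_addr_0.
have -> : \sum_(j <- iota 1 M) x j = z M.+1 - z 1%N.
  rewrite (eq_bigr _ (fun i _ => step i)).
  by have := @telescope_sumr _ 1 M.+1 z isT; rewrite /index_iota subn1.
rewrite count_predT size_iota mulrDl lerD2l.
have := zz M.+1; have := zz 1%N; rewrite !ler_norml; lra.
Qed.
End Amplification.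

(** * The while loop: outcome sums, cost, failure and termination *)

Section Loop.
Context {R : realType} {B : finType} (A : qop R B) (b0 : B) (good : pred B).
Context (N : nat) (c : R).
Hypothesis uA : unitary A.
Hypothesis c_gt1 : 1 < c.
Implicit Types (F : outcome B -> R) (s : seq (R * outcome B)) (K l u m M : nat) (tau : R).

Let p := gprob good (psiA A b0).
Notation gj j := (gprob good (psiQ A b0 good j)).
Notation bj j := (bprob good (psiQ A b0 good j)).
Notation loop tau := (qs_loop A b0 good N c tau).

Lemma Mof_itv l : c ^+ l <= (Mof c l)%:R < c ^+ l + 1.
Proof.
have /andP[lo hi] := ceil_itv (c ^+ l); rewrite natr_absz ger0_norm; last first.
  by rewrite ceil_ge0 (lt_le_trans (ltrN10 _))// exprn_ge0// ltW// (lt_trans ltr01).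
by rewrite hi -ltrBlDr; move: lo; rewrite rmorphB.
Qed.

Lemma cX_ge1 l : 1 <= c ^+ l.
Proof. by rewrite exprn_ege1 // ltW. Qed.

Lemma Mof_gt0 l : 0 < (Mof c l)%:R :> R.
Proof. by have := cX_ge1 l; have := Mof_itv l; lra. Qed.

Lemma cX_unbounded (y : R) : exists l, y < c ^+ l.
Proof.
(* Bernoulli's inequality. *)
have bern l : 1 + l%:R * (c - 1) <= c ^+ l.
  elim: l => [|l IH]; first by rewrite mul0r addr0 expr0.
  rewrite exprS -natr1; have := cX_ge1 l; move: c_gt1; nra.
exists (Num.bound (`|y| / (c - 1))); apply: lt_le_trans (bern _).
have c1 : 0 < c - 1 by rewrite subr_gt0.
have := archi_boundP (_ : 0 <= `|y| / (c - 1)).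
rewrite divr_ge0 ?(ltW c1)// => /(_ isT); rewrite ltr_pdivrMr//.
by have := ler_norm y; lra.
Qed.

(** The expectation of [F]. Total probability, failure probability and expected calls are all of
    this form, so one recursion serves the three. *)
Definition wsum F s : R := \sum_(x <- s) x.1 * F x.2.

Lemma wsum_cat F s1 s2 : wsum F (s1 ++ s2) = wsum F s1 + wsum F s2.
Proof. exact: big_cat. Qed.

Lemma wsum_scale F w s : wsum F (scale w s) = w * wsum F s.
Proof.
by rewrite /wsum big_map mulr_sumr; apply: eq_bigr => x _; rewrite mulrA.
Qed.

Lemma wsum_flatten (I : Type) F (h : I -> seq (R * outcome B)) (r : seq I) :
  wsum F (flatten [seq h i | i <- r]) = \sum_(i <- r) wsum F (h i).
Proof.
elim: r => [|i r IH]; first by rewrite /wsum /= !big_nil.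
by rewrite /= wsum_cat IH big_cons.
Qed.

Lemma wsum_found F (phi : nat -> R) (w : R) (psi : qstate R B) m :
  (forall b m, F (QFound b m) = phi m) ->
  wsum F [seq (w * prob (psi b), QFound b m) | b <- enum B & good b] = w * gprob good psi * phi m.
Proof.
move=> FE; rewrite /wsum big_map big_filter big_enum_cond /= mulr_sumr mulr_suml.
by apply: eq_bigr => b _; rewrite FE.
Qed.

Lemma wsum_loop F phi tau K l u m : (forall b m, F (QFound b m) = phi m) ->
  u%:R < qs_bound tau ->
  let M := Mof c l.+1 in
  let u' := if Num.sqrt N%:R < M%:R :> R then u.+1 else u in
  wsum F (loop tau K.+1 l u m) = M%:R^-1 * \sum_(j <- iota 1 M)
    (gj j * phi (m + (1 + 2 * j))%N + bj j * wsum F (loop tau K l.+1 u' (m + (1 + 2 * j))%N)).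
Proof.
move=> FE ub M u' /=; rewrite ub /= wsum_flatten mulr_sumr; apply: eq_bigr => j _.
by rewrite wsum_cat wsum_scale (wsum_found _ phi)// mulrDr !mulrA.
Qed.

Lemma loop_stop tau K l u m : ~~ (u%:R < qs_bound tau) ->
  loop tau K l u m = [:: (1, QFailed B m)].
Proof. by case: K => [|K] /= ->. Qed.

Lemma wsum1 F m : wsum F [:: (1, QFailed B m)] = F (QFailed B m).
Proof. by rewrite /wsum big_seq1 mul1r. Qed.

Lemma loop_total tau K l u m : wsum (fun=> 1) (loop tau K l u m) = 1.
Proof.
elim: K l u m => [|K IH] l u m; have [ub|ub] := boolP (u%:R < qs_bound tau);
  [|by rewrite loop_stop// wsum1| |by rewrite loop_stop// wsum1].
  by rewrite /= ub /wsum big_seq1 mulr1.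
rewrite (wsum_loop _ (fun=> 1))//.
under eq_bigr do rewrite IH !mulr1 gprobD//.
by rewrite big_const_seq count_predT size_iota iter_addr_0 mulVf// gt_eqF// Mof_gt0.
Qed.

(** The failure probability of a stage, j being uniform in [1, M]. *)
Definition bavg M : R := M%:R^-1 * \sum_(j <- iota 1 M) bj j.

Lemma bavg_ge0 M : 0 <= bavg M.
Proof. by rewrite mulr_ge0 ?invr_ge0// sumr_ge0// => j _; apply: bprob_ge0. Qed.

Lemma bavg_le1 M : (0 < M)%N -> bavg M <= 1.
Proof.
move=> M0; rewrite /bavg mulrC ler_pdivrMr ?ltr0n// mul1r.
have -> : M%:R = \sum_(j <- iota 1 M) 1 :> R.
  by rewrite big_const_seq count_predT size_iota iter_addr_0.
apply: ler_sum => j _; rewrite -(gprobD A b0 good uA j) lerDr; exact: gprob_ge0.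
Qed.

Lemma sum_calls m M : \sum_(j <- iota 1 M) (m + (1 + 2 * j))%:R = M%:R * (m + M + 2)%:R :> R.
Proof.
elim: M => [|M IH]; first by rewrite big_nil mul0r.
rewrite -[M.+1]addn1 iotaD big_cat big_seq1 /= IH -!natrM -natrD.
congr (_%:R); lia.
Qed.

Lemma sum_stage m M (V : R) : 0 < M%:R :> R ->
  \sum_(j <- iota 1 M) ((m + (1 + 2 * j))%:R + V * bj j) = M%:R * (m%:R + (M%:R + 2 + V * bavg M)).
Proof.
move=> M0; rewrite big_split /= sum_calls -mulr_sumr /bavg !natrD; field.
exact: lt0r_neq0.
Qed.

Definition ncalls (o : outcome B) : R := (calls o)%:R.

(** The success weight is replaced by one minus the failure weight: the calls of the stage are
    always paid, and only the excess of the continuation is weighted by failure. *)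
Lemma wsum_ncalls_loop tau K l u m : u%:R < qs_bound tau ->
  let M := Mof c l.+1 in
  let u' := if Num.sqrt N%:R < M%:R :> R then u.+1 else u in
  wsum ncalls (loop tau K.+1 l u m) = M%:R^-1 * \sum_(j <- iota 1 M)
    ((m + (1 + 2 * j))%:R + (wsum ncalls (loop tau K l.+1 u' (m + (1 + 2 * j))%N)
       - (m + (1 + 2 * j))%:R) * bj j).
Proof.
move=> ub M u'; rewrite (wsum_loop _ (fun m => m%:R))//; congr (_ * _).
apply: eq_bigr => j _; rewrite -/M -/u'; set k := _%:R.
by rewrite -[X in _ = X + _]mul1r -(gprobD A b0 good uA j); ring.
Qed.

(** The average of 1 + 2 j over 1 <= j <= M is M + 2, and a continuation costing at most V more is
    paid with probability [bavg M]. *)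
Lemma loop_calls_le tau K l u m V : u%:R < qs_bound tau ->
  let M := Mof c l.+1 in
  let u' := if Num.sqrt N%:R < M%:R :> R then u.+1 else u in
  (forall m', wsum ncalls (loop tau K l.+1 u' m') <= m'%:R + V) ->
  wsum ncalls (loop tau K.+1 l u m) <= m%:R + (M%:R + 2 + V * bavg M).
Proof.
move=> ub M u' IH; rewrite wsum_ncalls_loop// ler_pdivrMl ?Mof_gt0// -sum_stage ?Mof_gt0//.
by apply: ler_sum => j _; rewrite lerD2l ler_wpM2r ?bprob_ge0// lerBlDl IH.
Qed.

Lemma loop_calls_ge tau K l u m V : u%:R < qs_bound tau ->
  let M := Mof c l.+1 in
  let u' := if Num.sqrt N%:R < M%:R :> R then u.+1 else u in
  (forall m', m'%:R + V <= wsum ncalls (loop tau K l.+1 u' m')) ->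
  m%:R + (M%:R + 2 + V * bavg M) <= wsum ncalls (loop tau K.+1 l u m).
Proof.
move=> ub M u' IH; rewrite wsum_ncalls_loop// ler_pdivlMl ?Mof_gt0// -sum_stage ?Mof_gt0//.
by apply: ler_sum => j _; rewrite lerD2l ler_wpM2r ?bprob_ge0// lerBrDl IH.
Qed.

Lemma loop_calls_ge0 tau K l u m : m%:R <= wsum ncalls (loop tau K l u m).
Proof.
elim: K l u m => [|K IH] l u m; have [ub|ub] := boolP (u%:R < qs_bound tau);
  [|by rewrite loop_stop// wsum1| |by rewrite loop_stop// wsum1].
  by rewrite /= ub /wsum big_seq1 mul1r.
have h := loop_calls_ge tau K l u m 0 ub (fun m' => _).
apply: le_trans (h _) => [|m']; first by rewrite mul0r addr0 lerDl addr_ge0.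
by rewrite addr0.
Qed.


(** The average is at most 1/2 + 1 / (2 M s); the threshold on M makes the second term at most r -
    1/2. *)
Lemma bavg_le M (s r : R) : s ^+ 2 = 4 * p * (1 - p) -> 0 < s -> 1 / 2 < r ->
  1 / (2 * (r - 1 / 2) * s) <= M%:R -> bavg M <= r.
Proof.
move=> es s0 r0 hM; have d0 : 0 < r - 1 / 2 by rewrite subr_gt0.
have d : 0 < 2 * (r - 1 / 2) * s by rewrite !mulr_gt0.
have M0 : 0 < M%:R :> R by apply: lt_le_trans hM; rewrite divr_gt0.
rewrite /bavg ler_pdivrMl//; apply: le_trans (sum_bprob_psiQ A b0 good uA M s es s0) _.
have -> : 1 / (2 * s) = (r - 1 / 2) * (1 / (2 * (r - 1 / 2) * s)).
  by field; rewrite !lt0r_neq0//; lra.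
by have : (r - 1 / 2) * (1 / (2 * (r - 1 / 2) * s)) <= (r - 1 / 2) * M%:R; [rewrite ler_wpM2l// ltW|lra].
Qed.

Lemma bavg_ge M : (0 < M)%N -> 1 - (2 * M%:R + 1) ^+ 2 * p <= bavg M.
Proof.
move=> M0; rewrite /bavg ler_pdivlMl ?ltr0n//.
have p0 : 0 <= p := gprob_ge0 good _.
have -> : M%:R * (1 - (2 * M%:R + 1) ^+ 2 * p) = \sum_(j <- iota 1 M) (1 - (2 * M%:R + 1) ^+ 2 * p).
  by rewrite big_const_seq count_predT size_iota iter_addr_0 mulr_natl.
rewrite big_seq [leRHS]big_seq; apply: ler_sum => j; rewrite mem_iota => /andP[_ jM].
have e := gprobD A b0 good uA j; suff : gj j <= (2 * M%:R + 1) ^+ 2 * p by lra.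
apply: le_trans (gprob_psiQ_le A b0 good uA j) _; rewrite ler_wpM2r//.
by rewrite lerXn2r ?nnegrE ?addr_ge0// natrD natrM lerD2r ler_pM2l// ler_nat -ltnS.
Qed.

Lemma Mof_ub l : (Mof c l)%:R < 2 * c ^+ l.
Proof. by have := Mof_itv l; have := cX_ge1 l; lra. Qed.

(* L is the threshold on M past which a stage fails with probability at most r.  The
   added term is a potential: a stage costs at most 4 c x calls, where x = c^l; below L
   the potential drops by that much even if the stage surely fails, and above L it is
   proportional to x, which c r < 1 allows. *)
Lemma loop_calls_ub tau K l u m (L r k k1 : R) : 0 < L -> 0 <= r -> c * r < 1 ->
  (forall M, L <= M%:R -> bavg M <= r) ->
  k = 4 * c / (1 - c * r) -> k1 = 4 * c / (c - 1) ->
  wsum ncalls (loop tau K l u m) <= m%:R +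
    (if c ^+ l < L then (k1 + 4 * c + k * c) * L - k1 * c ^+ l else k * c ^+ l).
Proof.
move=> L0 r0 cr hL kE k1E.
have c0 : 0 < c by apply: lt_trans c_gt1.
have k0 : 0 < k by rewrite kE divr_gt0 ?mulr_gt0 ?subr_gt0.
have k10 : 0 < k1 by rewrite k1E divr_gt0 ?mulr_gt0 ?subr_gt0.
have ek : k * (1 - c * r) = 4 * c by rewrite kE divfK// subr_eq0 gt_eqF.
have ek1 : k1 * (c - 1) = 4 * c by rewrite k1E divfK// subr_eq0 gt_eqF.
have kc0 : 0 < k * c by rewrite mulr_gt0.
pose V x := if x < L then (k1 + 4 * c + k * c) * L - k1 * x else k * x.
rewrite -[X in _ + X]/(V (c ^+ l)).
have V0 x : 0 < x -> 0 <= V x.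
  move=> x0; rewrite /V; case: ifP => xL; last by rewrite mulr_ge0// ltW.
  have : k1 * x <= k1 * L by rewrite ler_wpM2l// ltW.
  have : 0 <= 4 * c * L by rewrite !mulr_ge0// ltW.
  have : 0 <= k * c * L by rewrite !mulr_ge0// ltW.
  by lra.
have x0 i : 0 < c ^+ i by rewrite exprn_gt0.
elim: K l u m => [|K IH] l u m; have [ub|ub] := boolP (u%:R < qs_bound tau);
  [|by rewrite loop_stop// wsum1 lerDl V0| |by rewrite loop_stop// wsum1 lerDl V0].
  by rewrite /= ub /wsum big_seq1 mul1r lerDl V0.
apply: le_trans (loop_calls_le tau K l u m _ ub (IH _ _)) _; rewrite lerD2l.
have := Mof_itv l.+1; have := Mof_gt0 l.+1; have := cX_ge1 l.+1; have := cX_ge1 l.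
have := hL (Mof c l.+1); have := @bavg_le1 (Mof c l.+1).
have := V0 _ (x0 l.+1); have := bavg_ge0 (Mof c l.+1).
set M := Mof _ _; rewrite exprS; set x := c ^+ l; set b := bavg M => bge0 V0' b1 br x1 cx1 M0 /andP[lo hi].
rewrite -(@ltr0n R) in b1; move/(_ M0): b1 => b1.
(* From M < c x + 1 and 1 <= c x. *)
have hM : M%:R + 2 <= 4 * c * x by lra.
have hVb : V (c * x) * b <= V (c * x) by rewrite ler_piMr.
have xcx : x <= c * x by rewrite ler_peMl ?(ltW c_gt1)//; lra.
have e1 : k1 * c * x = k1 * x + 4 * c * x by rewrite -ek1; ring.
have e2 : k * x = k * c * r * x + 4 * c * x by rewrite -ek; ring.
apply: le_trans (lerD hM (lexx _)) _; move: hVb; rewrite {2 4}/V.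
(* The stage stays below L, crosses it, or starts above it. Crossing dictates the coefficient of L:
   it must cover k1 x + 4 c x + k c x for x < L. *)
have [cxL|cxL] := ltP (c * x) L; last have [xL|xL] := ltP x L.
- by rewrite (le_lt_trans xcx cxL); lra.
- have : (k1 + 4 * c + k * c) * x <= (k1 + 4 * c + k * c) * L.
    by rewrite ler_wpM2l ?(ltW xL)// !addr_ge0 ?mulr_ge0 ?ltW.
  lra.
- move=> _; rewrite /V ltNge cxL /=.
  have /br br' : L <= M%:R by apply: le_trans cxL _.
  have : k * (c * x) * b <= k * (c * x) * r.
    by rewrite ler_wpM2l// mulrA mulr_ge0 ?(ltW kc0)//; lra.
  lra.
Qed.

Lemma terminated_found (w : R) (psi : qstate R B) m (bs : seq B) :
  terminated [seq (w * prob (psi b), QFound b m) | b <- bs].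
Proof. by rewrite /terminated all_map; apply/allP. Qed.

Lemma terminated_scale w s : terminated (scale w s) = terminated s.
Proof. by rewrite /terminated all_map. Qed.

Lemma terminated_flatten (I : Type) (h : I -> seq (R * outcome B)) (r : seq I) :
  terminated (flatten [seq h i | i <- r]) = all (fun i => terminated (h i)) r.
Proof. by elim: r => //= i r IH; rewrite -IH /terminated all_cat. Qed.

Lemma terminated_loopS tau K l u m : u%:R < qs_bound tau ->
  let M := Mof c l.+1 in
  let u' := if Num.sqrt N%:R < M%:R :> R then u.+1 else u in
  terminated (loop tau K.+1 l u m) =
  all (fun j => terminated (loop tau K l.+1 u' (m + (1 + 2 * j))%N)) (iota 1 M).
Proof.
move=> ub M u' /=; rewrite ub terminated_flatten; apply: eq_all => j /=.
rewrite {1}/terminated all_cat [X in X && _]terminated_found; exact: terminated_scale.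
Qed.

(** The counter of calls never influences the control flow. *)
Lemma terminated_calls tau K l u m m' :
  terminated (loop tau K l u m) = terminated (loop tau K l u m').
Proof.
elim: K l u m m' => [|K IH] l u m m'; have [ub|ub] := boolP (u%:R < qs_bound tau);
  [|by rewrite !loop_stop| |by rewrite !loop_stop]; first by rewrite /= ub.
by rewrite !terminated_loopS//; apply: eq_all => j; exact: IH.
Qed.

(** As M is positive, j = 1 is always a possible choice, so the continuation occurs in the
    unfolding. *)
Lemma terminated_loop_next tau K l u m m' : u%:R < qs_bound tau ->
  let u' := if Num.sqrt N%:R < (Mof c l.+1)%:R :> R then u.+1 else u in
  terminated (loop tau K.+1 l u m) -> terminated (loop tau K l.+1 u' m').
Proof.
move=> ub u'; rewrite terminated_loopS// => /allP/(_ 1%N).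
rewrite mem_iota /= addSn add0n ltnS -(@ltr0n R) Mof_gt0 => /(_ isT).
by rewrite (terminated_calls _ _ _ _ _ m').
Qed.

Lemma terminated_loop0 tau l u m : u%:R < qs_bound tau -> ~~ terminated (loop tau 0 l u m).
Proof. by rewrite /= => ->. Qed.

(* With x = c^l, a stage succeeds with probability at most 36 c^2 p x^2; the term
   D p x^2 makes the factor (1 / 2 + D p x^2), a lower bound for the probability of
   reaching the stage with c^l of order 1 / sqrt p, compensate for this loss. *)
Lemma loop_calls_lb tau K l m (q k D : R) : 0 < qs_bound tau ->
  0 < q -> q ^+ 2 = p -> 1 <= Num.sqrt N%:R * q -> 0 < k -> k <= 1 / 2 -> 0 < D ->
  D * (c ^+ 2 - 1) = 36 * c ^+ 2 -> D * c ^+ 2 * k ^+ 2 <= 1 / 2 ->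
  terminated (loop tau K l 0 m) -> c ^+ l * q < k ->
  m%:R + k / q * (1 / 2 + D * (p * (c ^+ l) ^+ 2)) <= wsum ncalls (loop tau K l 0 m).
Proof.
move=> bnd q0 eq qN k0 k2 D0 eD kD.
have c0 : 0 < c by apply: lt_trans c_gt1.
have kq0 : 0 < k / q by rewrite divr_gt0.
elim: K l m => [|K IH] l m tK xk; first by have := terminated_loop0 tau l 0 m bnd; rewrite tK.
have x1 := cX_ge1 l; have M0 := Mof_gt0 l.+1; have M2 := Mof_ub l.+1.
have /andP[lo _] := Mof_itv l.+1.
have hx : p * (c ^+ l) ^+ 2 <= k ^+ 2.
  by rewrite -eq -exprMn mulrC lerXn2r ?nnegrE ?mulr_ge0 ?ltW// (lt_le_trans ltr01).
move: lo M2; rewrite exprS; set M := Mof _ _ in M0 *; set x := c ^+ l in x1 xk hx * => lo M2.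
have W1 : 1 / 2 + D * (p * x ^+ 2) <= 1.
  have : D * (p * x ^+ 2) <= D * k ^+ 2 by rewrite ler_wpM2l// ltW.
  have : D * k ^+ 2 <= D * c ^+ 2 * k ^+ 2.
    by rewrite ler_wpM2r ?sqr_ge0// ler_peMr ?(ltW D0)// exprn_ege1// ltW.
  lra.
(* Once c x reaches k / q, the M >= c x calls of this single stage suffice. *)
have [ck|ck] := ltP (c * x * q) k; last first.
  have h := loop_calls_ge tau K l 0 m 0 bnd (fun m' => _).
  apply: le_trans (h _) => [|m']; last by rewrite addr0 loop_calls_ge0.
  rewrite lerD2l mul0r addr0 -/M.
  have : k / q * (1 / 2 + D * (p * x ^+ 2)) <= k / q * 1 by rewrite ler_wpM2l// ltW.
  have : k / q <= c * x by rewrite ler_pdivrMr.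
  lra.
(* Here M q <= 2 c x q < 2 k <= 1 <= sqrt N q, so u stays 0 and the loop cannot stop for lack of
   tolerance. *)
have MN : Num.sqrt N%:R < M%:R :> R = false.
  apply/negbTE; rewrite -leNgt -(ler_pM2r q0); apply: le_trans qN.
  have : M%:R * q <= 2 * (c * x) * q by rewrite ler_wpM2r// ltW.
  lra.
have h := loop_calls_ge tau K l 0 m (k / q * (1 / 2 + D * (p * (c * x) ^+ 2))) bnd (fun m' => _).
apply: le_trans (h _) => [|m']; last first.
  rewrite -/M MN -exprS; apply: IH; last by rewrite exprS.
  by have := terminated_loop_next tau K l 0 m m' bnd tK; rewrite -/M MN.
rewrite lerD2l -/M; have hb : 1 - 36 * c ^+ 2 * (p * x ^+ 2) <= bavg M.
  apply: le_trans (bavg_ge M _); last by rewrite -(@ltr0n R).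
  have : (2 * M%:R + 1) ^+ 2 <= (6 * (c * x)) ^+ 2.
    have : 1 <= M%:R :> R by rewrite ler1n -(@ltr0n R).
    by move=> ?; rewrite lerXn2r ?nnegrE//; lra.
  move/(ler_wpM2r (gprob_ge0 good (psiA A b0))); rewrite -/p; lra.
apply: (@le_trans _ _ (k / q * ((1 / 2 + D * (p * (c * x) ^+ 2)) * bavg M))); last first.
  by rewrite [leLHS]mulrA lerDr addr_ge0// ltW.
rewrite ler_wpM2l ?(ltW kq0)//.
have y0 : 0 <= p * x ^+ 2 by rewrite mulr_ge0 ?sqr_ge0 ?gprob_ge0.
have Dc0 : 0 <= D * c ^+ 2 by rewrite mulr_ge0 ?sqr_ge0 ?ltW.
have eD' : D * (p * (c * x) ^+ 2) = D * c ^+ 2 * (p * x ^+ 2) by ring.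
have hD : D * (p * (c * x) ^+ 2) <= 1 / 2 by rewrite eD'; apply: le_trans kD; rewrite ler_wpM2l.
have w0 : 0 <= D * (p * (c * x) ^+ 2) by rewrite eD' mulr_ge0.
apply: (@le_trans _ _ ((1 / 2 + D * (p * (c * x) ^+ 2)) * (1 - 36 * c ^+ 2 * (p * x ^+ 2)))); last first.
  by rewrite ler_wpM2l// addr_ge0.
have -> : (1 / 2 + D * (p * (c * x) ^+ 2)) * (1 - 36 * c ^+ 2 * (p * x ^+ 2)) =
  1 / 2 + D * (p * (c * x) ^+ 2) - (1 / 2 + D * (p * (c * x) ^+ 2)) * (36 * c ^+ 2 * (p * x ^+ 2)) by ring.
have : (1 / 2 + D * (p * (c * x) ^+ 2)) * (36 * c ^+ 2 * (p * x ^+ 2)) <= 36 * c ^+ 2 * (p * x ^+ 2).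
  have c36 : 0 <= 36 * c ^+ 2 by rewrite mulr_ge0 ?sqr_ge0.
  by rewrite ler_piMl//; [rewrite mulr_ge0|lra].
(* The growth of the weight from x to c x is exactly the loss 36 c^2 p x^2. *)
have : D * (p * (c * x) ^+ 2) = D * (p * x ^+ 2) + D * (c ^+ 2 - 1) * (p * x ^+ 2) by ring.
rewrite eD; lra.
Qed.

Definition nfailed (o : outcome B) : R := (is_failed o)%:R.

(** Here v counts stages with M > sqrt N that a failing run must still go through; each contributes
    a factor 7/8 and the other stages at most 1. *)
Lemma loop_fail_ub tau K l u m v :
  (forall M, Num.sqrt N%:R < M%:R :> R -> bavg M <= 7 / 8) ->
  (forall i, (i < v)%N -> (i + u)%:R < qs_bound tau) ->
  wsum nfailed (loop tau K l u m) <= (7 / 8) ^+ v.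
Proof.
move=> hb; have e0 i : 0 <= (7 / 8) ^+ i :> R by rewrite exprn_ge0.
elim: K l u m v => [|K IH] l u m v hv; have [ub|ub] := boolP (u%:R < qs_bound tau).
- by rewrite /= ub /wsum big_seq1 mulr0.
- case: v hv => [|v] hv; last by rewrite (hv 0%N isT) in ub.
  by rewrite loop_stop// wsum1.
- rewrite (wsum_loop _ (fun=> 0))//; set M := Mof c l.+1; set u' := (if _ then _ else _).
  have M0 : 0 < M%:R :> R := Mof_gt0 _.
  have [w [hw e]] : exists w, (forall i, (i < w)%N -> (i + u')%:R < qs_bound tau) /\
      bavg M * (7 / 8) ^+ w <= (7 / 8) ^+ v.
    have b1 : bavg M <= 1 by apply: bavg_le1; rewrite -(@ltr0n R).
    move: @u'; case: ifP => hM u'; last by exists v; split => //; rewrite ler_piMl.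
    case: v hv => [|v] hv; first by exists 0%N; split; rewrite // mulr1.
    exists v; split=> [i iv|]; first by rewrite addnS -addSn hv.
    by rewrite exprS ler_wpM2r// hb.
  apply: le_trans e; rewrite /bavg -mulrA ler_wpM2l ?invr_ge0// mulr_suml.
  apply: ler_sum => j _; rewrite mulr0 add0r ler_wpM2l ?bprob_ge0//; exact: IH.
- case: v hv => [|v] hv; last by rewrite (hv 0%N isT) in ub.
  by rewrite loop_stop// wsum1.
Qed.

(** The fuel covers the L - l stages before M must exceed sqrt N, plus the r increments of u that
    reach the bound. *)
Lemma loop_terminates tau K l u m r L : (forall i, (L <= i)%N -> Num.sqrt N%:R < (Mof c i)%:R :> R) ->
  qs_bound tau <= (u + r)%:R -> (r + (L - l) <= K)%N -> terminated (loop tau K l u m).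
Proof.
move=> hL; elim: K l u m r => [|K IH] l u m r hr hK;
  have [ub|ub] := boolP (u%:R < qs_bound tau);
  [|by rewrite loop_stop| |by rewrite loop_stop].
  by move: hK hr; rewrite leqn0 addn_eq0 => /andP[/eqP-> _]; rewrite addn0 leNgt ub.
case: r hr hK => [|r] hr hK; first by rewrite addn0 leNgt ub in hr.
rewrite terminated_loopS//; apply/allP => j _; case: ifP => hM.
  by apply: (IH _ _ _ r); [rewrite addSnnS|lia].
have lL : (l.+1 < L)%N by rewrite ltnNge; apply/negP => /hL; rewrite hM.
by apply: (IH _ _ _ r.+1) => //; lia.
Qed.

Lemma loop_stable tau K K' l u m : terminated (loop tau K l u m) -> (K <= K')%N ->
  loop tau K' l u m = loop tau K l u m.
Proof.
elim: K K' l u m => [|K IH] K' l u m tK hK;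
  have [ub|ub] := boolP (u%:R < qs_bound tau);
  [|by rewrite !loop_stop| |by rewrite !loop_stop].
  by have := terminated_loop0 tau l u m ub; rewrite tK.
case: K' hK => // K' hK; rewrite /= ub; congr flatten; apply: eq_map => j.
congr (_ ++ scale _ _); apply: IH => //; exact: terminated_loop_next tK.
Qed.
End Loop.

(** * The full search: first measurement, then the loop *)

Section Search.
Context {R : realType} {B : finType} (A : qop R B) (b0 : B) (good : pred B).
Context (N : nat) (c : R).
Hypothesis uA : unitary A.
Hypothesis c_gt1 : 1 < c.
Let p := gprob good (psiA A b0).
Notation loop tau := (qs_loop A b0 good N c tau).
Notation search tau := (qsearch A b0 good N c tau).

Lemma wsum_search F phi tau K : (forall b m, F (QFound b m) = phi m) ->
  wsum F (search tau K) = p * phi 1%N + (1 - p) * wsum F (loop tau K 0 0 1).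
Proof.
move=> FE; rewrite /qsearch wsum_cat wsum_scale; congr (_ + _ * _); last first.
  by rewrite -(gprobD_psiA A b0 good uA) addrC addKr.
rewrite -[p]mul1r -(wsum_found good F phi _ _ _ FE).
by congr wsum; apply: eq_map => b; rewrite mul1r.
Qed.

Lemma terminated_search tau K : terminated (search tau K) = terminated (loop tau K 0 0 1).
Proof.
rewrite /qsearch {1}/terminated all_cat -!/(terminated _) terminated_scale.
by rewrite {1}/terminated all_map all_predT.
Qed.

Lemma search_total tau K : total_prob (search tau K) = 1.
Proof.
transitivity (wsum (fun=> 1) (search tau K)).
  by apply: eq_bigr => x _; rewrite mulr1.
by rewrite (wsum_search _ (fun=> 1))// loop_total//; ring.
Qed.

Lemma search_fail tau K : fail_prob (search tau K) = (1 - p) * wsum nfailed (loop tau K 0 0 1).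
Proof.
transitivity (wsum nfailed (search tau K)).
  by rewrite /fail_prob big_mkcond; apply: eq_bigr => x _; rewrite /nfailed; case: is_failed; rewrite ?mulr1 ?mulr0.
by rewrite (wsum_search _ (fun=> 0))// mulr0 add0r.
Qed.

Lemma search_terminates tau : exists K0, (forall K, (K0 <= K)%N -> search tau K = search tau K0) /\
  terminated (search tau K0).
Proof.
have [L hL] := cX_unbounded c c_gt1 (Num.sqrt N%:R).
have hM i : (L <= i)%N -> Num.sqrt N%:R < (Mof c i)%:R :> R.
  move=> Li; apply: lt_le_trans hL _; apply: le_trans (_ : c ^+ i <= _).
    by rewrite ler_weXn2l// ltW.
  by have /andP[] := Mof_itv c c_gt1 i.
pose r := Num.bound `|qs_bound tau|.
have hr : qs_bound tau <= (0 + r)%:R.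
  by rewrite add0n; apply: ltW; apply: le_lt_trans (ler_norm _) (archi_boundP _).
have tK : terminated (search tau (r + L)).
  by rewrite terminated_search; apply: (loop_terminates A b0 good N c c_gt1 tau _ 0 0 1 r L) => //; rewrite subn0.
exists (r + L)%N; split=> // K hK; rewrite /qsearch; congr (_ ++ scale _ _).
by apply: loop_stable => //; rewrite -terminated_search.
Qed.

(** Entries of weight 0 may list any desired basis state, so only positive weights are constrained.
    Q stays in the plane of [scaled], so what is then found lies in the support of A|0>. *)
Definition sound_entry (x : R * outcome B) : bool :=
  (0 <= x.1) && ((0 < x.1) ==>
    if x.2 is QFound b _ then good b && (psiA A b0 b != 0) else true).

Lemma sound_scale w s : 0 <= w -> all sound_entry s -> all sound_entry (scale w s).
Proof.
move=> w0; rewrite /scale all_map; apply: sub_all => x /andP[x0 /implyP h].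
rewrite /sound_entry /= mulr_ge0//=; apply/implyP => wx; apply: h.
by rewrite lt_neqAle x0 andbT eq_sym; apply: contraTneq wx => ->; rewrite mulr0 ltxx.
Qed.

Lemma sound_found (w : R) (a b : R) m : 0 <= w ->
  all sound_entry [seq (w * prob (scaled A b0 good a b x), QFound x m) | x <- enum B & good x].
Proof.
move=> w0; rewrite all_map all_filter; apply/allP => x _ /=; apply/implyP => gx.
rewrite /sound_entry /= mulr_ge0 ?prob_ge0//= gx /=; apply/implyP; apply: contraTneq => px.
by rewrite /scaled px mulr0 /prob /= expr0n /= addr0 mulr0 ltxx.
Qed.

Lemma sound_loop tau K l u m : all sound_entry (loop tau K l u m).
Proof.
have s1 o : (forall b m, o <> QFound b m) -> all sound_entry [:: (1, o)].
  by move=> ho; rewrite /= /sound_entry ler01 andbT; apply/implyP => _; case: o ho => // b k /(_ b k).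
elim: K l u m => [|K IH] l u m; have [ub|ub] := boolP (u%:R < qs_bound tau);
  [|by rewrite loop_stop// s1| |by rewrite loop_stop// s1]; rewrite /= ub; first exact: s1.
elim: (iota _ _) => //= j r IHr; rewrite !all_cat IHr andbT psiQE// sound_found ?invr_ge0//=.
by rewrite sound_scale// mulr_ge0 ?invr_ge0// -psiQE//; apply: bprob_ge0.
Qed.

Lemma sound_search tau K : all sound_entry (search tau K).
Proof.
rewrite /qsearch all_cat sound_scale ?sound_loop//; last exact: bprob_ge0.
rewrite andbT; have := sound_found 1 1 1 1 ler01; congr (all _ _); apply: eq_map => b.
by rewrite mul1r /scaled if_same mul1r.
Qed.

End Search.

(** * Bounds on expected calls and failure of the full search *)

Lemma all_In (T : Type) (P : pred T) (s : seq T) x : all P s -> List.In x s -> P x.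
Proof. by elim: s => //= y s IH /andP[Py Ps] [<-|/IH]; [|apply]. Qed.

Lemma search_calls_ub (R : realType) (c : R) : 1 < c -> c < 2 -> exists2 c2 : R, 0 < c2 &
  forall (B : finType) (A : qop R B) b0 good N tau K, unitary A ->
  0 < gprob good (psiA A b0) ->
  expected_calls (qsearch A b0 good N c tau K) <= c2 / Num.sqrt (gprob good (psiA A b0)).
Proof.
move=> c1 c2.
have c0 : 0 < c by lra.
(* c < 2 leaves room for a failure rate r > 1/2 of the late stages with c r < 1. *)
pose r := (1 / 2 + 1 / c) / 2.
have cr : c * r = (c / 2 + 1) / 2 by rewrite /r; field; exact: lt0r_neq0.
have ic : 1 / 2 < 1 / c by rewrite ltr_pM2l// ltf_pV2 ?posrE.
have r2 : 1 / 2 < r by rewrite /r; lra.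
pose k := 4 * c / (1 - c * r); pose k1 := 4 * c / (c - 1).
have k0 : 0 < k by rewrite divr_gt0 ?mulr_gt0// subr_gt0 cr; lra.
have k10 : 0 < k1 by rewrite divr_gt0 ?mulr_gt0 ?subr_gt0.
pose K1 := k1 + 4 * c + k * c.
have K10 : 0 < K1 by have := mulr_gt0 k0 c0; rewrite /K1; lra.
pose e := 4 * (r - 1 / 2).
have e0 : 0 < e by rewrite mulr_gt0 ?subr_gt0.
have Ke := divr_gt0 K10 e0.
exists (1 + k + K1 / e); first by lra.
move=> B A b0 good N tau K uA; set p := gprob _ _ => p0.
have p1 : p <= 1 by exact: gprob_psiA_le1.
pose q := Num.sqrt p.
have q0 : 0 < q by rewrite sqrtr_gt0.
have q1 : q <= 1 by rewrite -[leRHS]sqrtr1 ler_wsqrtr.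
have qq : q ^+ 2 = p by rewrite sqr_sqrtr ?ltW.
have iq : 1 <= 1 / q by rewrite ler_pdivlMr ?mul1r.
rewrite -/q -[expected_calls _]/(wsum ncalls _) (wsum_search _ _ _ _ _ uA _ (fun m => m%:R))// -/p.
(* When p = 1 the loop has weight 0, and s below would vanish. *)
have [->|pn1] := eqVneq p 1.
  rewrite subrr mul0r addr0 !mul1r; apply: le_trans iq _.
  by rewrite ler_pM2r ?invr_gt0// -addrA lerDl addr_ge0 ?ltW// divr_gt0.
have pp : 0 < 1 - p by rewrite subr_gt0 lt_neqAle pn1.
pose q' := Num.sqrt (1 - p).
have q'0 : 0 < q' by rewrite sqrtr_gt0.
have q'1 : q' <= 1 by rewrite -[leRHS]sqrtr1 ler_wsqrtr//; lra.
have qq' : q' ^+ 2 = 1 - p by rewrite sqr_sqrtr ?ltW.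
pose s := 2 * q * q'.
have s0 : 0 < s by rewrite !mulr_gt0.
have es : s ^+ 2 = 4 * p * (1 - p) by rewrite -qq' -qq /s; ring.
pose L := 1 / (2 * (r - 1 / 2) * s).
have L0 : 0 < L by rewrite divr_gt0// !mulr_gt0 ?subr_gt0.
have := loop_calls_ub A b0 good N c uA c1 tau K 0 0 1 L r k k1 L0 _ _ _ erefl erefl.
rewrite expr0; set w := wsum _ _; set V := (if _ then _ else _).
have VK : V <= K1 * L + k.
  rewrite /V -/K1; case: ifP => _; last by rewrite mulr1 lerDr mulr_ge0// ltW.
  by rewrite lerD2l mulr1; lra.
move=> /(_ _ _ _)/le_trans hw.
have {}hw : w <= 1 + (K1 * L + k).
  apply: hw; last by rewrite lerD2l.
  - lra.
  - by rewrite cr; lra.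
  - by move=> M; apply: (bavg_le A b0 good uA M s r).
have : (1 - p) * w <= (1 - p) * (1 + (K1 * L + k)) by rewrite ler_wpM2l// ltW.
(* L = 1 / (e q q'), so the entrance probability 1 - p = q'^2 absorbs the q' that blows up L near p
   = 1. *)
have -> : (1 - p) * (1 + (K1 * L + k)) = (1 - p) + K1 / e * (q' / q) + (1 - p) * k.
  rewrite /L -qq' /s /e; field; rewrite !lt0r_neq0//; lra.
have : (1 - p) * k <= k * 1 by rewrite mulrC ler_wpM2l ?(ltW k0)//; lra.
have : K1 / e * (q' / q) <= K1 / e * (1 / q).
  by rewrite ler_wpM2l ?ler_pM2r ?invr_gt0// ltW// divr_gt0.
have : k * 1 <= k * (1 / q) by rewrite ler_wpM2l ?(ltW k0).
have -> : (1 + k + K1 / e) / q = 1 / q + k * (1 / q) + K1 / e * (1 / q) by ring.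
lra.
Qed.

Lemma search_calls_lb (R : realType) (c : R) : 1 < c -> exists2 c1 : R, 0 < c1 &
  forall (B : finType) (A : qop R B) b0 good N tau K, unitary A ->
  0 < gprob good (psiA A b0) -> 1 <= N%:R * gprob good (psiA A b0) -> 0 < qs_bound tau ->
  terminated (qsearch A b0 good N c tau K) ->
  c1 / Num.sqrt (gprob good (psiA A b0)) <= expected_calls (qsearch A b0 good N c tau K).
Proof.
move=> c1; have c0 : 0 < c by lra.
have c21 : 0 < c ^+ 2 - 1 by rewrite subr_gt0 exprn_egt1.
pose D := 36 * c ^+ 2 / (c ^+ 2 - 1).
have D0 : 0 < D by rewrite divr_gt0// mulr_gt0// exprn_gt0.
have eD : D * (c ^+ 2 - 1) = 36 * c ^+ 2 by rewrite /D divfK// gt_eqF.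
pose y := D * c ^+ 2.
have y1 : 1 <= y.
  have : c ^+ 2 - 1 <= c ^+ 2 by lra.
  have : 0 < c ^+ 2 by rewrite exprn_gt0.
  by rewrite /y -(ler_pM2r c21) mulrAC eD; nra.
(* With y >= 1 this gives both k <= 1/2 and D c^2 k^2 <= 1/2. *)
pose k := 1 / (2 * y).
have k0 : 0 < k by rewrite divr_gt0// mulr_gt0//; lra.
have yk : y * k = 1 / 2 by rewrite /k; field; rewrite lt0r_neq0//; lra.
have k2 : k <= 1 / 2 by nra.
exists (k / 4); first by rewrite divr_gt0.
move=> B A b0 good N tau K uA; set p := gprob _ _ => p0 pN bnd tK.
have p1 : p <= 1 by exact: gprob_psiA_le1.
pose q := Num.sqrt p.
have q0 : 0 < q by rewrite sqrtr_gt0.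
have qq : q ^+ 2 = p by rewrite sqr_sqrtr ?ltW.
have qN : 1 <= Num.sqrt N%:R * q by rewrite -sqrtrM// -[leLHS]sqrtr1 ler_wsqrtr.
rewrite -/q -[expected_calls _]/(wsum ncalls _) (wsum_search _ _ _ _ _ uA _ (fun m => m%:R))// -/p.
rewrite terminated_search in tK.
have kq : 0 < k / q by rewrite divr_gt0.
(* For small q the loop is entered with probability at least 1/2 and its bound applies; otherwise k
   / (4 q) <= 1 and the first preparation already pays. *)
have [qk|qk] := ltP q k.
  have := loop_calls_lb A b0 good N c uA c1 tau K 0 1 q k D bnd q0 qq qN k0 k2 D0 eD _ tK.
  rewrite expr0 [1 * q]mul1r => /(_ _ qk); set w := wsum _ _ => hw.
  have {}hw : 1 + k / q * (1 / 2) <= w.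
    apply: le_trans (hw _); last by rewrite -/y; nra.
    rewrite lerD2l ler_wpM2l ?(ltW kq)// lerDl.
    by rewrite mulr_ge0 ?(ltW D0)// expr1n mulr1 ltW.
  have p2 : p <= 1 / 2 by rewrite -qq; nra.
  have : (1 - p) * (1 + k / q * (1 / 2)) <= (1 - p) * w by rewrite ler_wpM2l//; lra.
  have : 1 / 2 * (k / q) <= (1 - p) * (k / q) by rewrite ler_wpM2r ?(ltW kq)//; lra.
  have -> : k / 4 / q = (k / q) / 4 by ring.
  lra.
have := loop_calls_ge0 A b0 good N c uA c1 tau K 0 0 1; set w := wsum _ _ => w1.
have : (1 - p) * 1 <= (1 - p) * w by rewrite ler_wpM2l// subr_ge0.
have : k / 4 / q <= 1 by rewrite ler_pdivrMr//; lra.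
lra.
Qed.

Lemma search_fail_ub (R : realType) (c : R) (B : finType) (A : qop R B) b0 good N tau K v :
  1 < c -> unitary A -> (0 < N)%N -> (exists2 t, (0 < t <= N)%N & gprob good (psiA A b0) = t%:R / N%:R) ->
  v%:R <= qs_bound tau ->
  fail_prob (qsearch A b0 good N c tau K) <= (7 / 8) ^+ v.
Proof.
move=> c1 uA N0 [t /andP[t0 tN]]; set p := gprob _ _ => pE hv.
have n0 : 0 < N%:R :> R by rewrite ltr0n.
have p0 : 0 <= p by exact: gprob_psiA_ge0.
have p1 : p <= 1 by exact: gprob_psiA_le1.
have e0 : 0 <= (7 / 8) ^+ v :> R by rewrite exprn_ge0.
(* If every point is improved, the first measurement always succeeds. *)
rewrite search_fail// -/p; have [tNE|tN'] := eqVneq t N.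
  by rewrite pE tNE divff ?gt_eqF// subrr mul0r.
apply: (@le_trans _ _ ((1 - p) * (7 / 8) ^+ v)); last by rewrite ler_piMl//; lra.
rewrite ler_wpM2l ?subr_ge0//; apply: loop_fail_ub => // [M hM|i iv]; last first.
  by apply: lt_le_trans hv; rewrite addn0 ltr_nat.
have pN : 1 <= p * N%:R by rewrite pE divfK ?gt_eqF// ler1n.
have pN' : 1 <= (1 - p) * N%:R.
  rewrite mulrBl mul1r pE divfK ?gt_eqF// -natrB// ler1n subn_gt0 ltn_neqAle tN'.
  by rewrite tN.
pose s := Num.sqrt (4 * p * (1 - p)).
have sp : 0 < 4 * p * (1 - p) by nra.
have s0 : 0 < s by rewrite sqrtr_gt0.
have es : s ^+ 2 = 4 * p * (1 - p) by rewrite sqr_sqrtr// ltW.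
apply: (bavg_le A b0 good uA M s (7 / 8)) => //; first by lra.
apply: le_trans (ltW hM).
have -> : 1 / (2 * (7 / 8 - 1 / 2) * s) = 4 / 3 / s by field; exact: lt0r_neq0.
rewrite ler_pdivrMr// -sqrtrM//.
have -> : 4 / 3 = Num.sqrt (16 / 9) :> R.
  have -> : 16 / 9 = (4 / 3) ^+ 2 :> R by field.
  by rewrite sqrtr_sqr ger0_norm.
rewrite ler_wsqrtr//.
(* Both p and 1 - p are at least 1/N, so p (1 - p) N >= 1 - 1/N >= 1/2 and 4 p (1 - p) N >= 2 >
   16/9. The rate 7/8 leaves this margin. *)
have n2 : 2 <= N%:R :> R by lra.
by nra.
Qed.

(** * The state prepared by the circuit of an instance *)

Section Instance.
Context {R : realType} (I : qss_instance R).
Local Notation n := (gi_n R I).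
Local Notation d := (gi_d R I).
Local Notation N := (gi_N R I).
Local Notation cx := (gi_cx R I).
Local Notation ef := (gi_ef R I).
Local Notation wk := (gi_wk R I).
Local Notation AI := (@gi_A R I).
Local Notation amp0 := (Complex (Num.sqrt N%:R : R)^-1 0).

Lemma qapply_sum_ket (B : finType) (U : qop R B) (k : R[i]) (h : 'I_N -> B) :
  qapply U (fun b => \sum_j k * ket R (h j) b) = fun b => \sum_j k * qapply U (ket R (h j)) b.
Proof.
apply/funext => b; under [RHS]eq_bigr do rewrite mulr_sumr.
rewrite exchange_big; apply: eq_bigr => b' _; rewrite mulr_sumr.
by apply: eq_bigr => j _; rewrite mulrCA.
Qed.

(** The basis state |x_j>|f_j>|f_j - f_k>. *)
Definition marked (j : 'I_N) : basis3 n d := ((cx j, ef (cx j)), addw wk (ef (cx j))).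

Lemma marked_inj : injective marked.
Proof. by move=> i j /(congr1 (fun b => b.1.1)) /(gi_cx_inj R I). Qed.

Lemma psiA_instance : psiA AI (zero3 n d) = fun b => \sum_j amp0 * ket R (marked j) b.
Proof.
rewrite /psiA /gi_A /Aop !qapply_comp.
have -> : qapply (on3 (gi_P R I)) (ket R (zero3 n d)) = ket R ((zero3 n d).1, wk).
  apply/funext => -[b1 b2]; rewrite qapply_ket /on3 /= -qapply_ket gi_P_spec /ket.
  by rewrite xpair_eqE andbC -mulnb natrM.
have -> : qapply (on1 (gi_W R I)) (ket R ((zero3 n d).1, wk)) =
    fun b => \sum_j amp0 * ket R (((cx j, zerow d), wk) : basis3 n d) b.
  apply/funext => -[[e x] w]; rewrite qapply_ket /on1 /= -qapply_ket.
  have /(congr1 (@^~ e)) -> := gi_W_spec R I; rewrite -mulr_sumr -mulrA; congr (_ * _).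
  have [/codomP[j ->]|nin] := boolP (e \in codom cx).
    rewrite mul1r (bigD1 j)//= big1 ?addr0 => [|i ij].
      by rewrite /ket !xpair_eqE eqxx.
    by rewrite /ket !xpair_eqE (inj_eq (gi_cx_inj R I)) eq_sym (negPf ij).
  rewrite mul0r big1// => j _; rewrite /ket !xpair_eqE.
  by case: eqP nin => // ->; rewrite codom_f.
rewrite qapply_sum_ket.
have FE j : qapply (on12 (gi_F R I)) (ket R (((cx j, zerow d), wk) : basis3 n d)) =
    ket R (((cx j, ef (cx j)), wk) : basis3 n d).
  apply/funext => -[b1 b2]; rewrite qapply_ket /on12 /= -qapply_ket gi_F_spec /ket.
  by rewrite xpair_eqE -mulnb natrM.
under [X in qapply _ X]eq_fun do under eq_bigr do rewrite FE.
rewrite qapply_sum_ket; apply/funext => b; apply: eq_bigr => j _.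
by rewrite qapply_ket.
Qed.

Lemma psiA_marked j : psiA AI (zero3 n d) (marked j) = amp0.
Proof.
rewrite psiA_instance (bigD1 j)//= big1 ?addr0 => [|i ij]; first by rewrite /ket eqxx mulr1.
by rewrite /ket (inj_eq marked_inj) eq_sym (negPf ij) mulr0.
Qed.

Lemma psiA_neq0 b : psiA AI (zero3 n d) b != 0 -> exists j, b = marked j.
Proof.
have [/codomP[j ->] _|nin] := boolP (b \in codom marked); first by exists j.
rewrite psiA_instance big1 ?eqxx// => j _; rewrite /ket.
by case: eqP nin => [->|]; rewrite ?codom_f ?mulr0.
Qed.

(** Without overflow the third register really encodes f_j - f_k, and its sign bit tells whether
    this is negative. *)
Lemma desired3_marked j :
  desired3 (marked j) = (gi_f R I (gi_x j) < gi_f R I (gi_xk R I)).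
Proof.
rewrite /desired3 /= -(fxval_lt0 R (gi_q R I) _ (gi_d_gt0 R I)) gi_no_overflow.
by rewrite subr_lt0.
Qed.

(** The [marked] states are pairwise distinct, each of probability 1/N, and t of them are
    desired. *)
Lemma gprob_instance :
  gprob (@desired3 n d) (psiA AI (zero3 n d)) = (gi_t I)%:R / N%:R.
Proof.
rewrite /gi_t; set J := [set j | _].
have -> : gprob (@desired3 n d) (psiA AI (zero3 n d)) =
    \sum_(b in [set marked j | j in J]) prob (psiA AI (zero3 n d) b).
  rewrite /gprob big_mkcond [RHS]big_mkcond; apply: eq_bigr => b _.
  have [->|/psiA_neq0 [j ->]] := eqVneq (psiA AI (zero3 n d) b) 0.
    by rewrite /prob /= expr0n /= addr0 !if_same.
  by rewrite (mem_imset _ _ marked_inj) inE desired3_marked.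
rewrite big_imset /=; last by move=> i j _ _; exact: marked_inj.
under eq_bigr do rewrite psiA_marked.
rewrite sumr_const /prob /= expr0n addr0 exprVn sqr_sqrtr//.
by rewrite mulr_natl.
Qed.

Lemma gi_t_le : (gi_t I <= N)%N.
Proof. by rewrite /gi_t (leq_trans (max_card _))// card_ord. Qed.

Lemma unitary_gi_A : unitary AI.
Proof.
by apply: unitary_Aop; [exact: gi_W_unitary|exact: gi_F_unitary|exact: gi_P_unitary].
Qed.

End Instance.

(** * The tolerance, and the quantum search step *)

Lemma ln34_lt0 (R : realType) : ln (3 / 4) < 0 :> R.
Proof. by rewrite ln_lt0//; apply/andP; split; lra. Qed.

(** Both logarithms are negative; the loop is then entered after a failed first measurement, as the
    lower bound on calls requires. *)
Lemma qs_bound_gt0 (R : realType) (tau : R) : 0 < tau < 1 -> 0 < qs_bound tau.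
Proof. by move=> /ln_lt0 h; rewrite /qs_bound nmulr_rgt0// invr_lt0 ln34_lt0. Qed.

Lemma qs_bound_ge (R : realType) (tau : R) v : 0 < tau <= (3 / 4) ^+ v -> v%:R <= qs_bound tau.
Proof.
move=> /andP[t0 tv]; rewrite /qs_bound ler_ndivlMr ?ln34_lt0// [leRHS]mulr_natl.
have p34 : 0 < 3 / 4 :> R by lra.
by rewrite -lnXn// ler_ln// posrE// exprn_gt0.
Qed.

Theorem theorem2 (R : realType) (c : R) (hc : 1 < c < 2) :
  (* the Quantum Search Step always terminates (finitely many loop iterations) *)
  (forall tau : R, 0 < tau -> forall I : qss_instance R,
     exists K0 : nat,
       (forall K : nat, (K0 <= K)%N -> qss_run I c tau K = qss_run I c tau K0) /\
       terminated (qss_run I c tau K0)) /\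
  (* exactly one of: (i) an improved mesh point is returned, (ii) failure *)
  (forall tau : R, 0 < tau -> forall (I : qss_instance R) (K : nat),
     terminated (qss_run I c tau K) ->
     (forall x, List.In x (qss_run I c tau K) -> 0 <= x.1) /\
     total_prob (qss_run I c tau K) = 1 /\
     (forall x, List.In x (qss_run I c tau K) -> 0 < x.1 ->
        if x.2 is QFound b _ then
          exists j, b.1.1 = gi_cx R I j /\ gi_f R I (gi_x j) < gi_f R I (gi_xk R I)
        else True)) /\
  (* expected number of oracle calls is Theta(sqrt (N / t)) *)
  (forall tau : R, 0 < tau < 1 ->
     exists c1 c2 : R, 0 < c1 /\ 0 < c2 /\
       forall (I : qss_instance R) (K : nat), (0 < gi_t I)%N ->
         terminated (qss_run I c tau K) ->
         c1 * Num.sqrt ((gi_N R I)%:R / (gi_t I)%:R) <= expected_calls (qss_run I c tau K)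
         /\ expected_calls (qss_run I c tau K) <= c2 * Num.sqrt ((gi_N R I)%:R / (gi_t I)%:R)) /\
  (* if X contains an improved mesh point, the failure probability can be made
     arbitrarily small by the choice of tau *)
  (forall I : qss_instance R, (0 < gi_t I)%N ->
     forall eps : R, 0 < eps -> exists tau0 : R, 0 < tau0 /\
       forall (tau : R) (K : nat), 0 < tau <= tau0 -> terminated (qss_run I c tau K) ->
         fail_prob (qss_run I c tau K) <= eps).
Proof.
have /andP[c1 c2] := hc; split; [|split; [|split]].
- by move=> tau _ I; exact: search_terminates.
- move=> tau _ I K _; have uA := unitary_gi_A I.
  have sound x := all_In _ _ _ x (sound_search (@gi_A R I) _ (@desired3 _ _) (gi_N R I) c uA tau K).
  split; first by move=> x /sound /andP[].
  split; first exact: search_total.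
  move=> [w [b k|k|k]] //= /sound /andP[_ /implyP h] /h /= /andP[].
  move=> + /psiA_neq0 [j bE]; rewrite bE desired3_marked => imp.
  by exists j.
- have [k2 k20 ub] := search_calls_ub R c c1 c2; have [k1 k10 lb] := search_calls_lb R c c1.
  move=> tau tau01; exists k1, k2; split=> //; split=> // I K t0 tK.
  have uA := unitary_gi_A I; have pE := gprob_instance I.
  have N0 : 0 < (gi_N R I)%:R :> R by rewrite ltr0n gi_N_gt0.
  have p0 : 0 < (gi_t I)%:R / (gi_N R I)%:R :> R by rewrite divr_gt0// ltr0n.
  have -> : Num.sqrt ((gi_N R I)%:R / (gi_t I)%:R) = (Num.sqrt ((gi_t I)%:R / (gi_N R I)%:R))^-1 :> R.
    by rewrite -sqrtrV ?ltW// invf_div.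
  rewrite -pE in p0 *; split; last exact: ub.
  apply: lb => //; last exact: qs_bound_gt0.
  by rewrite pE mulrCA divff ?gt_eqF// mulr1 ler1n.
- move=> I t0 eps eps0.
  have c87 : 1 < 8 / 7 :> R by lra.
  (* This v gives (7/8)^v < eps, and tau <= (3/4)^v forces a failing run through at least v stages
     with M > sqrt N. *)
  have [v hv] := cX_unbounded _ c87 (1 / eps).
  exists ((3 / 4) ^+ v); split; first by rewrite exprn_gt0.
  move=> tau K /qs_bound_ge tauv _.
  apply: le_trans (search_fail_ub _ c _ _ _ _ _ tau K v c1 (unitary_gi_A I) (gi_N_gt0 R I) _ tauv) _.
    by exists (gi_t I); rewrite ?t0 ?gi_t_le ?gprob_instance.
  have -> : 7 / 8 = (8 / 7)^-1 :> R by rewrite invf_div.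
  rewrite exprVn -[leRHS]invrK lef_pV2 ?posrE ?invr_gt0 ?exprn_gt0//.
  by rewrite -div1r ltW.
Qed.
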